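(* Let $L$ be a bounded chain and $n\geqslant 1$. A function $f\colon L^n\to L$ is comonotonic maxitive if and only if there exists a function $g\colon L^n\to L$ satisfying $\mathbf{P_2}$ such that, for every $\mathbf{x}=(x_1,\ldots,x_n)\in L^n$, $$f(\mathbf{x})=\bigvee_{I\subseteq [n]} g\Big(\mathbf{e}_I\wedge\bigwedge_{i\in I}x_i\Big).$$ In this case, we can choose $g=f$ (i.e., $f$ itself satisfies $\mathbf{P_2}$ and the displayed identity holds with $g=f$).
   Context: $L$ is a bounded chain (totally ordered set) with least element $0$, greatest element $1$, and $\wedge=\min$, $\vee=\max$. $[n]=\{1,\ldots,n\}$. $L^n$ carries the componentwise order and operations; for $\mathbf{x}\in L^n$ and $c\in L$, $\mathbf{x}\wedge c=(x_1\wedge c,\ldots,x_n\wedge c)$. $\{0,1\}^n\subseteq L^n$ uses the bounds $0,1$ of $L$. For $I\subseteq[n]$, $\mathbf{e}_I\in\{0,1\}^n$ is the tuple whose $i$th component is $1$ if and only if $i\in I$. The empty meet is $1$. For a permutation $\sigma$ of $[n]$, $L^n_\sigma=\{\mathbf{x}\in L^n: x_{\sigma(1)}\leqslant\cdots\leqslant x_{\sigma(n)}\}$. Vectors $\mathbf{x},\mathbf{x}'\in L^n$ are comonotonic if there is a permutation $\sigma$ of $[n]$ with $\mathbf{x},\mathbf{x}'\in L^n_\sigma$. $f\colon L^n\to L$ is comonotonic maxitive if $f(\mathbf{x}\vee\mathbf{x}')=f(\mathbf{x})\vee f(\mathbf{x}')$ for any two comonotonic $\mathbf{x},\mathbf{x}'\in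 L^n$. $\mathbf{P_2}$ (for a function $g$): $g(\mathbf{e}\wedge c)\leqslant g(\mathbf{e}\wedge c')$ for all $\mathbf{e}\in\{0,1\}^n$ and all $c,c'\in L$ with $c\leqslant c'$. *)

(* Defs.v *)
From mathcomp Require Import all_boot all_order all_fingroup.

Set Implicit Arguments.
Unset Strict Implicit.
Unset Printing Implicit Defensive.

Import Order.TTheory.

Local Open Scope order_scope.

(* The cube L^n is [n.-tupleprod L]: n-tuples with the componentwise order and
   lattice operations, the components being indexed by 'I_n = {0, ..., n-1}
   instead of {1, ..., n}.  On the bounded chain L, [\bot] and [\top] are the
   bounds 0 and 1, and [`&`] and [`|`] are min and max ([meetEtotal],
   [joinEtotal]). *)

Section Cube.

Context {d : Order.disp_t} {L : tbOrderType d} {n : nat}.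

Implicit Types (x y e : n.-tupleprod L) (c : L) (I : {set 'I_n}).
Implicit Types (f g : n.-tupleprod L -> L) (s : {perm 'I_n}).

Definition meet_const x c : n.-tupleprod L := [tuple tnth x i `&` c | i < n].

Definition is_01 e : Prop :=
  forall i : 'I_n, tnth e i = \bot \/ tnth e i = \top.

Definition indic I : n.-tupleprod L :=
  [tuple if i \in I then \top else \bot | i < n].

Definition in_simplex s x : Prop :=
  forall i j : 'I_n, (i <= j)%N -> tnth x (s i) <= tnth x (s j).

Definition comonotonic x y : Prop :=
  exists s : {perm 'I_n}, in_simplex s x /\ in_simplex s y.

Definition comonotonic_maxitive f : Prop :=
  forall x y, comonotonic x y -> f (x `|` y) = f x `|` f y.

Definition P2 g : Prop :=
  forall e c c', is_01 e -> c <= c' -> g (meet_const e c) <= g (meet_const e c').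

(* For I = set0, the inner meet is [\top]. *)
Definition max_representation f g : Prop :=
  forall x,
    f x = \join_(I : {set 'I_n})
            g (meet_const (indic I) (\meet_(i in I) tnth x i)).

End Cube.

(* Main.v *)
(** A comonotonic maxitive [f] is monotone along comonotonic pairs. For a set
    [I] and [c = min_I x], the superset [J = {i | c <= x_i}] of [I] links
    [e_I /\ c] to [x] by two such pairs, [e_I /\ c <= e_J /\ c <= x]; the direct
    pair need not be comonotonic. So every term of the join is below [f x].
    Conversely [x] is the join of the vectors [e_J /\ x_i] with
    [J = {j | x_i <= x_j}], which are all sorted by any permutation sorting [x].
    For the converse implication, on comonotonic [x] and [y] the minima of [x],
    of [y] and of [x \/ y] over [I] are attained at a common index. *)
Require Import Defs.
From mathcomp Require Import all_boot all_order all_fingroup.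

Set Implicit Arguments.
Unset Strict Implicit.
Unset Printing Implicit Defensive.

Import Order.TTheory.

Local Open Scope order_scope.

(** Sorting the list of all indices by [k] only permutes it; [s] is read off from that
    permutation. *)
Lemma exists_sorting_perm (d : Order.disp_t) (T : orderType d) (n : nat)
    (k : 'I_n -> T) :
  exists s : {perm 'I_n}, forall i j : 'I_n, (i <= j)%N -> k (s i) <= k (s j).
Proof.
pose r := relpre k <=%O.
have /tuple_permP[s sE] : perm_eq (sort r (enum 'I_n)) (ord_tuple n).
  by rewrite perm_sort val_ord_tuple.
exists s => i j le_ij.
have r_sorted : sorted r (sort r (enum 'I_n)).
  by apply: sort_sorted => a b; apply: le_total.
have r_trans : transitive r by move=> a b c; apply: le_trans.
have r_refl : reflexive r by move=> a; apply: lexx.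
have sz : size (sort r (enum 'I_n)) = n by rewrite size_sort size_enum_ord.
have nthE (a : 'I_n) : nth i (sort r (enum 'I_n)) a = s a.
  by rewrite sE -tnth_nth tnth_mktuple tnth_ord_tuple.
have := sorted_leq_nth r_trans r_refl i r_sorted.
by move=> /(_ i j); rewrite !inE sz !ltn_ord !nthE; apply.
Qed.

Section ComonotonicMaxitive.

Context {d : Order.disp_t} {L : tbOrderType d} {n : nat}.

Implicit Types (x y e : n.-tupleprod L) (c : L) (I J : {set 'I_n}).
Implicit Types (f g : n.-tupleprod L -> L) (s : {perm 'I_n}).

(** A permutation that sorts the key [k] sorts both vectors, so comonotonicity reduces to finding a
    common key. *)
Lemma comonotonic_key (d' : Order.disp_t) (T : orderType d') (k : 'I_n -> T) x y :
  (forall i j, k i <= k j -> tnth x i <= tnth x j) ->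
  (forall i j, k i <= k j -> tnth y i <= tnth y j) ->
  comonotonic x y.
Proof.
move=> kx ky; have [s sP] := exists_sorting_perm k.
by exists s; split=> i j /sP; [apply: kx | apply: ky].
Qed.

Lemma letprodP x y : reflect (forall i, tnth x i <= tnth y i) (x <= y).
Proof. by rewrite leEtprod; apply: forallP. Qed.

Lemma tnth_meet_const x c i : tnth (meet_const x c) i = tnth x i `&` c.
Proof. exact: tnth_mktuple. Qed.

Lemma tnth_meet_indic I c i :
  tnth (meet_const (indic I) c) i = if i \in I then c else \bot.
Proof.
by rewrite tnth_meet_const tnth_mktuple; case: ifP; rewrite (meet1x, meet0x).
Qed.

Lemma is_01_indic I : is_01 (indic I : n.-tupleprod L).
Proof. by move=> i; rewrite tnth_mktuple; case: ifP; [right | left]. Qed.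

Lemma meet_indic0 c : meet_const (indic set0) c = \bot :> n.-tupleprod L.
Proof.
apply/le_anti; rewrite le0x andbT; apply/letprodP => i.
by rewrite tnth_meet_indic inE le0x.
Qed.

Definition upper_level x c : {set 'I_n} := [set i | c <= tnth x i].

(** Level sets are closed upwards along [x], so every permutation sorting [x] also sorts these
    vectors. *)
Lemma upper_level_homo x c c' i j :
  tnth x i <= tnth x j ->
  tnth (meet_const (indic (upper_level x c)) c') i
    <= tnth (meet_const (indic (upper_level x c)) c') j.
Proof.
move=> le_ij; rewrite !tnth_meet_indic !inE.
by case: ifP => [/le_trans/(_ le_ij) -> | _]; rewrite ?le0x.
Qed.

(** This identifies the vectors of [join_upper_level] with arguments occurring in the
    representation. *)
Lemma meet_upper_level x i : \meet_(j in upper_level x (tnth x i)) tnth x j = tnth x i.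
Proof.
apply/le_anti/andP; split; first by apply: meets_inf; rewrite inE.
by apply: meets_ge => j; rewrite inE.
Qed.

Lemma join_upper_level x :
  x = \join_(i < n) meet_const (indic (upper_level x (tnth x i))) (tnth x i).
Proof.
apply/le_anti/andP; split.
  apply/letprodP => i; apply: le_trans.
    2: by apply/letprodP; apply: (@joins_sup _ _ _ i).
  by rewrite tnth_meet_indic inE lexx.
apply/joinsP => i _; apply/letprodP => j; rewrite tnth_meet_indic inE.
by case: ifP; rewrite ?le0x.
Qed.

Lemma in_simplex_join s x y :
  in_simplex s x -> in_simplex s y -> in_simplex s (x `|` y).
Proof. by move=> sx sy i j le_ij; rewrite !tnth_join leU2 ?sx ?sy. Qed.

Lemma comonotonic_maxitive_le f x y :
  comonotonic_maxitive f -> comonotonic x y -> x <= y -> f x <= f y.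
Proof. by move=> fM xy /join_idPl xyE; rewrite -xyE joinC fM // leUl. Qed.

Lemma comonotonic_maxitive_P2 f : comonotonic_maxitive f -> P2 f.
Proof.
move=> fM e c c' _ cc'; apply: comonotonic_maxitive_le => //; last first.
  by apply/letprodP => i; rewrite !tnth_meet_const leI2.
by apply: (@comonotonic_key _ _ (tnth e)) => i j le_ij;
  rewrite !tnth_meet_const leI2.
Qed.

Lemma comonotonic_indic I J c c' :
  I \subset J ->
  comonotonic (meet_const (indic I) c) (meet_const (indic J) c').
Proof.
move=> /subsetP IJ.
(* The key is 0 outside [J], 1 on [J] minus [I], and 2 on [I]. *)
apply: (@comonotonic_key _ _ (fun i => (i \in I) + (i \in J))%N) => i j;
  rewrite !tnth_meet_indic leEnat.
- case: ifP => [Ii|_]; last by rewrite le0x.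
  by rewrite IJ //; case: (j \in I) => //; case: (j \in J).
- case: (boolP (i \in J)) => [_|_]; last by rewrite le0x.
  by case: (boolP (j \in I)) => [/IJ ->|_] //; case: (j \in J) => //; rewrite addn1.
Qed.

Lemma comonotonic_maxitive_indic_le f x I :
  comonotonic_maxitive f ->
  f (meet_const (indic I) (\meet_(i in I) tnth x i)) <= f x.
Proof.
move=> fM; set c := \meet_(i in I) _.
have IJ : I \subset upper_level x c.
  by apply/subsetP => i Ii; rewrite inE; apply: meets_inf.
apply: (@le_trans _ _ (f (meet_const (indic (upper_level x c)) c))).
  apply: comonotonic_maxitive_le (comonotonic_indic _ _ IJ) _ => //.
  apply/letprodP => i; rewrite !tnth_meet_indic.
  by case: ifP => [/(subsetP IJ) -> | _]; rewrite ?le0x.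
apply: comonotonic_maxitive_le => //.
  by apply: (@comonotonic_key _ _ (tnth x)) => // i j; apply: upper_level_homo.
by apply/letprodP => i; rewrite tnth_meet_indic inE; case: ifP; rewrite ?le0x.
Qed.

Lemma comonotonic_maxitive_representation f :
  comonotonic_maxitive f -> max_representation f f.
Proof.
move=> fM x; apply/le_anti/andP; split; last first.
  by apply/joinsP => I _; apply: comonotonic_maxitive_indic_le.
set b := (X in _ <= X).
have leb I : f (meet_const (indic I) (\meet_(i in I) tnth x i)) <= b.
  exact: (@joins_sup _ _ _ I).
have [s xs] := exists_sorting_perm (tnth x).
(* Maxitivity applies to comonotonic vectors only, so the induction on the join also keeps every
   partial join sorted by [s]. *)
pose P z := in_simplex s z /\ f z <= b.
suff: P x by case.
rewrite [x in P x]join_upper_level.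
apply: (big_ind P) => [|y z [ys yb] [zs zb]|i _].
(* The value of [f] at the empty join [\bot] may be nonzero; it is bounded by the term for
   [set0]. *)
- rewrite -(meet_indic0 (\meet_(i in set0) tnth x i)); split; last exact: leb.
  by move=> i j _; rewrite !tnth_meet_indic !inE.
- split; first exact: in_simplex_join.
  by rewrite fM ?leUx ?yb //; exists s.
- split; first by move=> j k /xs; apply: upper_level_homo.
  by rewrite -[X in meet_const _ X]meet_upper_level.
Qed.

(** The minimum over [I] sits at the element of [I] that [s] lists first, a position that depends on
    [s] and [I] but not on [x]. *)
Lemma in_simplex_meet s x i I :
  in_simplex s x -> s i \in I -> (forall j, s j \in I -> (i <= j)%N) ->
  \meet_(j in I) tnth x j = tnth x (s i).
Proof.
move=> xs Ii imin; apply/le_anti/andP; split; first exact: meets_inf.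
apply: meets_ge => j Ij; rewrite -(permKV s j).
by apply: xs; apply: imin; rewrite permKV.
Qed.

Lemma representation_comonotonic_maxitive f g :
  P2 g -> max_representation f g -> comonotonic_maxitive f.
Proof.
move=> gP fE.
(* By [P2] each term of the join grows with [x], so [f] is monotone on the whole cube; this gives
   one of the two inequalities. *)
have f_le x y : x <= y -> f x <= f y.
  move=> /letprodP xy; rewrite !fE; apply/joinsP => I _.
  apply: (@joins_min _ _ _ I) => //; apply: gP; first exact: is_01_indic.
  by apply: meets_ge => i Ii; apply: le_trans (xy i); apply: meets_inf.
have g_le x I : g (meet_const (indic I) (\meet_(i in I) tnth x i)) <= f x.
  by rewrite fE; apply: (@joins_sup _ _ _ I).
move=> x y [s [xs ys]]; apply/le_anti/andP; split; last first.
  by rewrite leUx !f_le ?leUl ?leUr.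
rewrite [leLHS]fE; apply/joinsP => I _.
(* The empty set has no first index, but its vector is [\bot] for every [x]. *)
have [->|[a Ia]] := set_0Vmem I.
  apply: le_trans (leUl _ _); apply: le_trans (g_le x set0).
  by rewrite !meet_indic0.
have Ia' : s ((s^-1)%g a) \in I by rewrite permKV.
have [i Ii imin] :=
  @arg_minnP _ _ (fun i => s i \in I) (fun i : 'I_n => i : nat) Ia'.
rewrite (in_simplex_meet (in_simplex_join xs ys) Ii imin) tnth_join.
(* In a chain the join at [s i] is the component of [x] or of [y], so the term for [I] is already a
   term of [f x] or of [f y]. *)
have [_|_] := leP (tnth x (s i)) (tnth y (s i)).
  by rewrite -(in_simplex_meet ys Ii imin) lexU2 // g_le orbT.
by rewrite -(in_simplex_meet xs Ii imin) lexU2 // g_le.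
Qed.

End ComonotonicMaxitive.

Theorem theorem8 (d : Order.disp_t) (L : tbOrderType d) (n : nat)
    (n_ge1 : (1 <= n)%N) (f : n.-tupleprod L -> L) :
  (comonotonic_maxitive f <->
     exists g : n.-tupleprod L -> L, P2 g /\ max_representation f g)
  /\ (comonotonic_maxitive f -> P2 f /\ max_representation f f).
Proof.
have self : comonotonic_maxitive f -> P2 f /\ max_representation f f.
  move=> fM; split; first exact: comonotonic_maxitive_P2.
  exact: comonotonic_maxitive_representation.
split=> //; split=> [/self fP|[g [gP fE]]]; first by exists f.
exact: representation_comonotonic_maxitive gP fE.
Qed.
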